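(* Let $(M,g)$ be a pseudo-Riemannian Einstein manifold of dimension $n\ge3$ with scalar curvature $\mathrm{Sc}\ne0$, let $k\in\mathbb{Z}_{>0}$, and let $f$ be a smooth function on $M$. The inhomogeneous problem $P_ku=f$ for the GJMS operator $P_k$ is equivalent to the second order problem $$(Y+b_1\mathrm{Sc})u_1=f,\ \ldots,\ (Y+b_k\mathrm{Sc})u_k=f,\qquad b_i=\frac{i(1-i)}{n(n-1)},$$ in the sense that solutions $u$ of the former are in 1-1 correspondence with solutions $(u_1,\ldots,u_k)$ of the latter. From a solution $(u_1,\ldots,u_k)$ of the second order problem we obtain the solution $u$ of $P_ku=f$ as $$u=\Big(-\frac{n(n-1)}{\mathrm{Sc}}\Big)^{k-1}\sum_{i=1}^{k}\Big[\prod_{j\ne i,\,1\le j\le k}\frac{1}{(j-i)(j+i-1)}\Big]u_i.$$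
   Context: Einstein means that the Ricci curvature is proportional to the metric; the scalar curvature $\mathrm{Sc}$ (metric trace of Ricci) is then constant. $\Delta=\delta d=\nabla^*\nabla$ is the positive energy Laplacian on functions. The conformal Laplacian is $Y=\Delta+\frac{n(n-2)}{4n(n-1)}\mathrm{Sc}$. On an Einstein manifold, for any $k\in\mathbb{Z}_{>0}$, the (order $2k$) GJMS operator means $$P_k=\prod_{i=1}^{k}(\Delta+c_i\mathrm{Sc}),\qquad c_i=\frac{(n+2i-2)(n-2i)}{4n(n-1)},$$ equivalently $P_k=\prod_{i=1}^{k}(Y+b_i\mathrm{Sc})$. All functions are smooth; an empty product is $1$. *)

(* Defs.v *)
From HB Require Import structures.
From mathcomp Require Import all_boot all_order all_algebra.
From mathcomp Require Import all_classical all_reals all_analysis.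

Set Implicit Arguments.
Unset Strict Implicit.
Unset Printing Implicit Defensive.

Import Order.TTheory GRing.Theory Num.Theory.
Import numFieldNormedType.Exports.

Local Open Scope classical_set_scope.
Local Open Scope ring_scope.

Section LocalCalculus.
Context {R : realType} {n : nat}.
Implicit Types (U : set 'rV[R]_n) (h : 'rV[R]_n -> R) (x : 'rV[R]_n).

Definition partial (i : 'I_n) h : 'rV[R]_n -> R := fun x => 'D_(delta_mx 0 i) h x.

(* U is meant to be open. *)
Fixpoint Ck (k : nat) U h : Prop :=
  match k with
  | 0 => forall x, U x -> {for x, continuous h}
  | k'.+1 => (forall x, U x -> differentiable h x)
             /\ forall i, Ck k' U (partial i h)
  end.

Definition smooth_on U h := forall k, Ck k U h.

Section MetricInCoordinates.
Variable g : 'rV[R]_n -> 'M[R]_n.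
Implicit Types (i j k l : 'I_n).

Definition christoffel k i j x : R :=
  2^-1 * \sum_l invmx (g x) k l *
    (partial i (fun y => g y j l) x + partial j (fun y => g y i l) x
     - partial l (fun y => g y i j) x).

(* Sign convention: the round sphere has positive Ricci curvature. *)
Definition ricci_coord x : 'M[R]_n := \matrix_(i, j)
  \sum_k (partial k (christoffel k i j) x - partial j (christoffel k i k) x
    + \sum_l (christoffel k k l x * christoffel l i j x
              - christoffel k j l x * christoffel l i k x)).

Definition scalar_coord x : R :=
  \sum_i \sum_j invmx (g x) i j * ricci_coord x i j.

(* A 1-form is given by its components w_j; the entry (i, j) of the covariant
   derivative is (nabla_i w)_j. *)
Definition cov_deriv (w : 'I_n -> 'rV[R]_n -> R) x : 'M[R]_n := \matrix_(i, j)
  (partial i (w j) x - \sum_k christoffel k i j x * w k x).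

Definition codiff_coord (w : 'I_n -> 'rV[R]_n -> R) x : R :=
  - \sum_i \sum_j invmx (g x) i j * cov_deriv w x i j.

Definition laplacian_coord h x : R := codiff_coord (fun j => partial j h) x.

End MetricInCoordinates.
End LocalCalculus.

(* Chart maps are total functions; only [cmap] on [cdom] and [cinv] on
   [cimg] are meaningful. *)
Record chart (R : realType) (n : nat) (M : topologicalType) := Chart {
  cdom : set M;
  cimg : set 'rV[R]_n;
  cmap : M -> 'rV[R]_n;
  cinv : 'rV[R]_n -> M;
  cdom_open : open cdom;
  cimg_open : open cimg;
  cmap_img : forall p, cdom p -> cimg (cmap p);
  cinv_dom : forall x, cimg x -> cdom (cinv x);
  cmapK : forall p, cdom p -> cinv (cmap p) = p;
  cinvK : forall x, cimg x -> cmap (cinv x) = x;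
  cmap_continuous : {within cdom, continuous cmap};
  cinv_continuous : {within cimg, continuous cinv} }.

Section Charts.
Context {R : realType} {n : nat} {M : topologicalType}.

Definition transition (a b : chart R n M) : 'rV[R]_n -> 'rV[R]_n :=
  fun x => cmap b (cinv a x).

Definition overlap (a b : chart R n M) : set 'rV[R]_n :=
  [set x | cimg a x /\ cdom b (cinv a x)].

End Charts.

(* [chart_at] is an arbitrary choice of a chart around each point, used only to
   evaluate at a point quantities that are given by coordinate formulas. *)
Record smooth_manifold (R : realType) (n : nat) (M : topologicalType) :=
  SmoothManifold {
  man_hausdorff : hausdorff_space M;
  man_second_countable : @second_countable M;
  chart_index : Type;
  atlas : chart_index -> chart R n M;
  chart_at : M -> chart_index;
  chart_at_dom : forall p, cdom (atlas (chart_at p)) p;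
  atlas_compatible : forall (a b : chart_index) (j : 'I_n),
    smooth_on (overlap (atlas a) (atlas b))
      (fun x => transition (atlas a) (atlas b) x 0 j) }.

(* The components of the metric in every chart of the atlas. The Jacobian acts
   on row vectors: its entry (i, c) is the i-th partial derivative of the c-th
   component. The signature is locally constant by nondegeneracy. *)
Record pseudo_riemannian_metric (R : realType) (n : nat) (M : topologicalType)
    (S : smooth_manifold R n M) := PseudoRiemannianMetric {
  metric : chart_index S -> 'rV[R]_n -> 'M[R]_n;
  metric_smooth : forall a i j,
    smooth_on (cimg (atlas a)) (fun x => metric a x i j);
  metric_sym : forall a x, cimg (atlas a) x -> (metric a x)^T = metric a x;
  metric_nondegenerate : forall a x, cimg (atlas a) x -> metric a x \in unitmx;
  metric_change : forall a b x, overlap (atlas a) (atlas b) x ->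
    let t := transition (atlas a) (atlas b) in
    metric a x = jacobian t x *m metric b (t x) *m (jacobian t x)^T }.

Section Geometry.
Context {R : realType} {n : nat} {M : topologicalType}.
Context {S : smooth_manifold R n M}.

Definition smooth_fun (u : M -> R) :=
  forall a : chart_index S,
    smooth_on (cimg (atlas a)) (fun x => u (cinv (atlas a) x)).

Variable g : pseudo_riemannian_metric S.
Implicit Types (u : M -> R) (p : M).

Definition einstein := exists lam : R,
  forall (a : chart_index S) x, cimg (atlas a) x ->
    ricci_coord (metric g a) x = lam *: metric g a x.

Definition scalar_curvature p : R :=
  scalar_coord (metric g (chart_at S p)) (cmap (atlas (chart_at S p)) p).

(* The positive energy Laplacian delta d. *)
Definition laplacian u : M -> R := fun p =>
  laplacian_coord (metric g (chart_at S p))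
    (fun x => u (cinv (atlas (chart_at S p)) x))
    (cmap (atlas (chart_at S p)) p).

Definition laplacian_plus_Sc (c : R) u : M -> R :=
  fun p => laplacian u p + c * scalar_curvature p * u p.

Definition conformal_laplacian u : M -> R :=
  laplacian_plus_Sc ((n%:R * (n%:R - 2)) / (4 * n%:R * (n%:R - 1))) u.

Definition conformal_laplacian_plus_Sc (b : R) u : M -> R :=
  fun p => conformal_laplacian u p + b * scalar_curvature p * u p.

Definition gjms_coef (i : nat) : R :=
  ((n%:R + 2 * i%:R - 2) * (n%:R - 2 * i%:R)) / (4 * n%:R * (n%:R - 1)).

(* The GJMS operator of order 2k, as a composition of second order operators. *)
Definition gjms (k : nat) : (M -> R) -> (M -> R) :=
  \big[comp/id]_(1 <= i < k.+1) laplacian_plus_Sc (gjms_coef i).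

Definition gjms_b (i : nat) : R := (i%:R * (1 - i%:R)) / (n%:R * (n%:R - 1)).

Definition gjms_solutions (k : nat) (f : M -> R) : set (M -> R) :=
  [set u | smooth_fun u /\ gjms k u = f].

(* u_i in the mathematical notation is [us] at the ordinal i - 1. *)
Definition second_order_solutions (k : nat) (f : M -> R) :
    set ('I_k -> M -> R) :=
  [set us | forall i : 'I_k, smooth_fun (us i) /\
     conformal_laplacian_plus_Sc (gjms_b i.+1) (us i) = f].

Definition reassemble (k : nat) (us : 'I_k -> M -> R) : M -> R := fun p =>
  (- ((n%:R * (n%:R - 1)) / scalar_curvature p)) ^+ k.-1 *
  \sum_(i < k)
    (\prod_(j < k | j != i)
       ((j.+1%:R - i.+1%:R) * (j.+1%:R + i.+1%:R - 1))^-1) * us i p.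

End Geometry.
Arguments smooth_fun {R n M} S u.
Arguments gjms_solutions {R n M S} g k f.
Arguments second_order_solutions {R n M S} g k f.
Arguments reassemble {R n M S} g k us.

(* Main.v *)
Require Import Defs.
From mathcomp Require Import all_boot all_order all_algebra.
From mathcomp Require Import all_classical all_reals all_analysis.
From mathcomp Require Import ring.
Import Order.TTheory GRing.Theory Num.Theory.
Import numFieldNormedType.Exports.
Local Open Scope classical_set_scope.
Local Open Scope ring_scope.

Set Implicit Arguments.
Unset Strict Implicit.
Unset Printing Implicit Defensive.

(** The Einstein condition makes the scalar curvature a constant s, so all the
operators at hand are polynomials in the Laplacian T: the i-th second order
operator is T + c_i s, and the GJMS operator is the product of these. As Sc is
nonzero, the numbers c_i s are pairwise distinct, because
c_j - c_i = - (j - i)(j + i - 1) / (n (n - 1)). Hence 1 / prod_i (X + c_i s)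
has a partial fraction decomposition, that is, sum_i w_i q_i = 1 with
q_i = prod_(j != i) (X + c_j s) and w_i = prod_(j != i) 1 / ((c_j - c_i) s)
([lagrange_cofactor]), and the w_i are the coefficients in the formula for u.
Applied to T, this identity shows that u |-> (q_i(T) u)_i is inverse to
(u_i)_i |-> sum_i w_i u_i; see [shift_systems_bij], which concerns any operator
that is linear on a subspace and preserves it.

What remains is that the Laplacian is such an operator on smooth functions.
Linearity is a computation in one chart. That the Laplacian of a smooth function
is smooth rests on its independence of the chart ([laplacianE]), since the
Laplacian is computed at each point in a chart chosen for that point alone. The
independence is the classical fact that the covariant Hessian is a tensor: under
a change of coordinates the second derivatives of the coordinate change enter
both the second derivatives of the function and the Christoffel symbols, and
they cancel ([hessian_change], an identity between finite arrays of numbers).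
The analytic input is the chain rule [partial_comp] and the symmetry of second
derivatives [derive_schwarz]. *)

(** * Functions of class C^k on an open set of R^n *)

(** Both functions have the same first order expansion at [x], so the
differential of [f] also serves [g]. *)
Lemma near_eq_differentiable (R : numFieldType) (V W : normedModType R)
    (f g : V -> W) (x : V) :
  (\near x, f x = g x) -> differentiable f x -> differentiable g x.
Proof.
move=> fg df.
have [dfc dfx] := (diff_locallyP _ _).1 df.
have E : g \o shift x = cst (g x) + 'd f x +o_ 0 id.
  apply/eqaddoP => e e0; move/eqaddoP: dfx => /(_ e e0) /= H.
  have fg0 : \forall h \near 0, f (h + x) = g (h + x).
    rewrite [\forall h \near _, _](near_shift x) sub0r.
    by near=> y; rewrite /= subrK; near: y.
  near=> h; rewrite -(nbhs_singleton fg).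
  suff : `|f (h + x) - (f x + 'd f x h)| <= e * `|h|.
    by rewrite (_ : f (h + x) = g (h + x)) //; near: h.
  by near: h.
have Ed := diff_unique dfc E.
by apply/diff_locallyP; rewrite Ed.
Unshelve. all: by end_near. Qed.

Section SmoothFunctions.
Context {R : realType} {n : nat}.
Implicit Types (U : set 'rV[R]_n) (f g h : 'rV[R]_n -> R) (x : 'rV[R]_n).

Lemma eq_on_near U f g x : open U -> U x -> {in U, f =1 g} ->
  \near x, f x = g x.
Proof.
move=> Uo Ux fg; near=> y; apply: fg; rewrite inE; near: y.
exact: open_nbhs_nbhs.
Unshelve. all: by end_near. Qed.

Lemma partial_eq U f g i x : open U -> U x -> {in U, f =1 g} ->
  partial i f x = partial i g x.
Proof. by move=> Uo Ux fg; apply: near_eq_derive; apply: eq_on_near fg. Qed.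

Lemma partialD f g i x : differentiable f x -> differentiable g x ->
  partial i (fun y => f y + g y) x = partial i f x + partial i g x.
Proof. by move=> df dg; rewrite /partial deriveD //; exact: diff_derivable. Qed.

Lemma partialM f g i x : differentiable f x -> differentiable g x ->
  partial i (fun y => f y * g y) x = partial i f x * g x + f x * partial i g x.
Proof.
move=> df dg; rewrite /partial deriveM; try exact: diff_derivable.
by rewrite addrC mulrC.
Qed.

Lemma partialV f i x : differentiable f x -> f x != 0 ->
  partial i (fun y => (f y)^-1) x = - ((f x)^-1 * (f x)^-1 * partial i f x).
Proof.
move=> df f0; rewrite /partial deriveV //; last exact: diff_derivable.
by rewrite /GRing.scale /= expr2 invfM mulNr.
Qed.

Lemma partial_cst (c : R) i x : partial i (fun=> c) x = 0.
Proof. exact: derive_cst. Qed.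

Lemma partial_sum (I : Type) (r : seq I) (F : I -> 'rV[R]_n -> R) i x :
  (forall j, differentiable (F j) x) ->
  differentiable (fun y => \sum_(j <- r) F j y) x /\
  partial i (fun y => \sum_(j <- r) F j y) x = \sum_(j <- r) partial i (F j) x.
Proof.
move=> dF; elim: r => [|j r [IHd IHp]].
  under eq_fun do rewrite big_nil.
  by rewrite big_nil partial_cst; split => //; exact: differentiable_cst.
under eq_fun do rewrite big_cons.
by rewrite big_cons partialD // IHp; split => //; exact: differentiableD.
Qed.

(** A derivative sees only germs. All later closure properties use this on an
open set: a formula for [partial i f] that holds on [U] alone is enough to
transfer [Ck]. *)
Lemma Ck_eq k U f g : open U -> {in U, f =1 g} -> Ck k U f -> Ck k U g.
Proof.
move=> Uo; elim: k f g => [|k IH] f g fg /=.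
  move=> cf x Ux; have E := eq_on_near Uo Ux fg.
  have E0 : f x = g x := nbhs_singleton E.
  suff : g y @[y --> x] --> g x by [].
  by rewrite -E0; apply: cvg_trans (near_eq_cvg E) (cf x Ux).
case=> df Hf; split=> [x Ux|i].
  exact: near_eq_differentiable (eq_on_near Uo Ux fg) (df x Ux).
apply: IH (Hf i) => x; rewrite inE => Ux.
exact: partial_eq fg.
Qed.

Lemma CkW k U f : Ck k.+1 U f -> Ck k U f.
Proof.
elim: k f => [|k IH] f [df Hf]; first by move=> x /df /differentiable_continuous.
by split => // i; apply: IH.
Qed.

Lemma Ck_cst k U (c : R) : Ck k U (fun=> c).
Proof.
elim: k c => [|k IH] c /=; first by move=> x _; exact: cst_continuous.
split=> [x _|i]; first exact: differentiable_cst.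
suff -> : partial i (fun=> c) = fun=> 0 by [].
by apply/funext => x; rewrite partial_cst.
Qed.

Lemma CkD k U f g : open U -> Ck k U f -> Ck k U g ->
  Ck k U (fun x => f x + g x).
Proof.
move=> Uo; elim: k f g => [|k IH] f g /=.
  by move=> cf cg x Ux; exact: continuousD (cf x Ux) (cg x Ux).
move=> [df Hf] [dg Hg]; split=> [x Ux|i].
  exact: differentiableD (df x Ux) (dg x Ux).
apply: Ck_eq (IH _ _ (Hf i) (Hg i)) => // x; rewrite inE => Ux.
by rewrite partialD; auto.
Qed.

(** The Leibniz rule gives the partial derivatives of a product at one order
lower, so the induction also needs the two factors themselves at that lower
order, whence [CkW]. *)
Lemma CkM k U f g : open U -> Ck k U f -> Ck k U g ->
  Ck k U (fun x => f x * g x).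
Proof.
move=> Uo; elim: k f g => [|k IH] f g.
  by move=> cf cg x Ux; exact: continuousM (cf x Ux) (cg x Ux).
move=> Cf Cg; have [df Hf] := Cf; have [dg Hg] := Cg; split=> [x Ux|i].
  exact: differentiableM (df x Ux) (dg x Ux).
apply: Ck_eq (CkD Uo (IH _ _ (Hf i) (CkW Cg)) (IH _ _ (CkW Cf) (Hg i))) => //.
by move=> x; rewrite inE => Ux; rewrite partialM; auto.
Qed.

(** The derivative of 1/f is - f'/f^2, a product of functions one order lower. *)
Lemma CkV k U f : open U -> (forall x, U x -> f x != 0) -> Ck k U f ->
  Ck k U (fun x => (f x)^-1).
Proof.
move=> Uo f0; elim: k => [|k IH].
  by move=> cf x Ux; exact: continuousV (f0 x Ux) (cf x Ux).
move=> Cf; have [df Hf] := Cf; split=> [x Ux|i].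
  exact: differentiableV (df x Ux) (f0 x Ux).
have CV := IH (CkW Cf).
apply: Ck_eq (CkM Uo (Ck_cst k U (-1)) (CkM Uo (CkM Uo CV CV) (Hf i))) => //.
by move=> x; rewrite inE => Ux; rewrite partialV ?mulN1r; auto.
Qed.

Lemma Ck_sum k U (I : Type) (r : seq I) (P : pred I) (F : I -> 'rV[R]_n -> R) :
  open U -> (forall i, P i -> Ck k U (F i)) ->
  Ck k U (fun x => \sum_(i <- r | P i) F i x).
Proof.
move=> Uo CF; elim: r => [|i r IH].
  by under eq_fun do rewrite big_nil; exact: Ck_cst.
under eq_fun do rewrite big_cons.
by case Pi: (P i) => //; apply: CkD => //; apply: CF.
Qed.

Lemma Ck_prod k U (I : Type) (r : seq I) (P : pred I) (F : I -> 'rV[R]_n -> R) :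
  open U -> (forall i, P i -> Ck k U (F i)) ->
  Ck k U (fun x => \prod_(i <- r | P i) F i x).
Proof.
move=> Uo CF; elim: r => [|i r IH].
  by under eq_fun do rewrite big_nil; exact: Ck_cst.
under eq_fun do rewrite big_cons.
by case Pi: (P i) => //; apply: CkM => //; apply: CF.
Qed.

Lemma smooth_partial U f i : smooth_on U f -> smooth_on U (partial i f).
Proof. by move=> Sf k; case: (Sf k.+1) => _; apply. Qed.

Lemma smooth_differentiable U f x : smooth_on U f -> U x -> differentiable f x.
Proof. by move=> Sf; case: (Sf 1) => + _; apply. Qed.

Lemma smooth_continuous U f x : smooth_on U f -> U x -> {for x, continuous f}.
Proof. by move=> Sf Ux; exact: (Sf 0). Qed.

Lemma smooth_det U m (A : 'rV[R]_n -> 'M[R]_m) : open U ->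
  (forall i j, smooth_on U (fun x => A x i j)) ->
  smooth_on U (fun x => \det (A x)).
Proof.
move=> Uo SA k; rewrite /determinant; apply: Ck_sum => // s _.
apply: CkM => //; first exact: Ck_cst.
by apply: Ck_prod => // i _; exact: SA.
Qed.

(** Cramer's rule: the entries of the inverse are cofactors divided by the
determinant. *)
Lemma smooth_invmx U m (A : 'rV[R]_n -> 'M[R]_m) : open U ->
  (forall i j, smooth_on U (fun x => A x i j)) ->
  (forall x, U x -> A x \in unitmx) ->
  forall i j, smooth_on U (fun x => invmx (A x) i j).
Proof.
move=> Uo SA uA i j k.
apply: (@Ck_eq _ _ (fun x => (\det (A x))^-1 *
  ((-1) ^+ (j + i) * \det (row' j (col' i (A x)))))) => //.
  by move=> x; rewrite inE => /uA Ax; rewrite /invmx Ax !mxE.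
apply: CkM => //.
  apply: CkV => // [x /uA|]; first by rewrite unitmxE unitfE.
  exact: smooth_det.
apply: CkM => //; first exact: Ck_cst.
apply: smooth_det => // i' j'; under eq_fun do rewrite !mxE; exact: SA.
Qed.

End SmoothFunctions.

(** * Symmetry of second derivatives and the chain rule *)

Section Schwarz.
Context {R : realType} {V : normedModType R}.
Implicit Types (h : V -> R) (x y u v : V).

Lemma is_derive_line h y u (r : R) : derivable h (r *: u + y) u ->
  is_derive r 1 (fun a : R => h (a *: u + y)) ('D_u h (r *: u + y)).
Proof.
have E : (fun k : R => k^-1 *: (h ((k *: 1 + r) *: u + y) - h (r *: u + y))) =
         (fun k : R => k^-1 *: (h (k *: u + (r *: u + y)) - h (r *: u + y))).
  by apply/funext => k; rewrite scalerDl addrA [k *: 1]mulr1.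
by move=> dh; split; [rewrite /derivable E|rewrite /derive E].
Qed.

Lemma line_MVT h y u (s : R) : 0 < s ->
  (forall a, 0 <= a <= s -> derivable h (a *: u + y) u) ->
  exists2 a, 0 <= a <= s & h (s *: u + y) - h y = s * 'D_u h (a *: u + y).
Proof.
move=> s0 dh.
have dl a : a \in `[0, s] ->
    is_derive a 1 (fun a : R => h (a *: u + y)) ('D_u h (a *: u + y)).
  by rewrite in_itv /= => /dh; exact: is_derive_line.
pose F : R -> R := fun a => h (a *: u + y).
pose dF : R -> R := fun a => 'D_u h (a *: u + y).
have FdF (a : R) : a \in `]0, s[%R -> is_derive a 1 F (dF a).
  by move=> /subset_itv_oo_cc; exact: dl.
have Fc : {within `[0, s], continuous F}.
  by apply: derivable_within_continuous => a /dl [].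
have [a] := MVT_segment (ltW s0) FdF Fc.
rewrite /F /dF => {F dF FdF Fc}.
rewrite in_itv /= scale0r add0r subr0 => as_ ->.
by exists a => //; rewrite mulrC.
Qed.

(** The mean value theorem along [u] for y |-> h (s v + y) - h y, and then along
[v] for the derivative it produces. The left-hand side is symmetric in [u] and
[v], which is what makes the two mixed derivatives comparable. *)
Lemma second_difference h x u v (s : R) : 0 < s ->
  (forall a b, 0 <= a <= s -> 0 <= b <= s ->
    derivable h (a *: u + (b *: v + x)) u /\
    derivable ('D_u h) (b *: v + (a *: u + x)) v) ->
  exists a b, [/\ 0 <= a <= s, 0 <= b <= s &
    h (s *: u + (s *: v + x)) - h (s *: u + x) - h (s *: v + x) + h x =
    s ^+ 2 * 'D_v ('D_u h) (b *: v + (a *: u + x))].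
Proof.
move=> s0 dh.
have ss : 0 <= s <= s by rewrite lexx ltW.
have zs : 0 <= (0 : R) <= s by rewrite lexx ltW.
have d1 a : 0 <= a <= s -> is_derive (a *: u + x) u
    (fun y => h (s *: v + y) - h y)
    ('D_u h (s *: v + (a *: u + x)) - 'D_u h (a *: u + x)).
  move=> as_.
  have [hs _] := dh a s as_ ss; have [h0 _] := dh a 0 as_ zs.
  rewrite scale0r add0r in h0.
  apply: is_deriveB; last exact: derivableP.
  (* The increment along [u] commutes with the translation by [s *: v]. *)
  have E : (fun k : R => k^-1 *: (h (s *: v + (k *: u + (a *: u + x))) -
      h (s *: v + (a *: u + x)))) = (fun k : R =>
      k^-1 *: (h (k *: u + (a *: u + (s *: v + x))) - h (a *: u + (s *: v + x)))).
    by apply/funext => k; rewrite !(addrCA (s *: v)).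
  rewrite addrCA.
  by split; [rewrite /derivable E|rewrite /derive E].
have [|a as_] := @line_MVT (fun y => h (s *: v + y) - h y) x u s s0.
  by move=> a /d1 [].
have [_ ->] := d1 a as_.
have [|b bs ->] := @line_MVT ('D_u h) (a *: u + x) v s s0.
  by move=> b bs; have [] := dh a b as_ bs.
move=> E; exists a, b; split => //.
rewrite expr2 -mulrA -E (addrCA (s *: v)); ring.
Qed.

Lemma dist_lt_double (p q c e : R) :
  `|p - c| < e -> `|q - c| < e -> `|p - q| < e + e.
Proof.
move=> pc qc; rewrite -(subrKA c); apply: le_lt_trans (ler_normD _ _) _.
by apply: ltrD => //; rewrite distrC.
Qed.

(** By [second_difference], used once in each order, each mixed derivative takes
the value of the second difference divided by s^2 somewhere within distance
O(s) of [x]. Both are continuous at [x], so their values at [x] agree. *)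
Lemma derive_schwarz h x u v :
  (\forall y \near x, [/\ derivable h y u, derivable h y v,
     derivable ('D_u h) y v & derivable ('D_v h) y u]) ->
  {for x, continuous ('D_v ('D_u h))} -> {for x, continuous ('D_u ('D_v h))} ->
  'D_v ('D_u h) x = 'D_u ('D_v h) x.
Proof.
move=> dh c1 c2; apply/eqP; apply: contraT => neq.
pose A := 'D_v ('D_u h); pose B := 'D_u ('D_v h).
pose e := `|A x - B x| / 2.
have e0 : 0 < e by rewrite divr_gt0 // normr_gt0 subr_eq0.
have n1 : \forall y \near x, `|A x - A y| < e by move/cvgrPdist_lt: c1; apply.
have n2 : \forall y \near x, `|B x - B y| < e by move/cvgrPdist_lt: c2; apply.
have /nbhs_ballP[d /= d0 Hd] : \forall y \near x, [/\ derivable h y u,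
     derivable h y v, derivable ('D_u h) y v & derivable ('D_v h) y u] /\
     (`|A x - A y| < e /\ `|B x - B y| < e).
  exact: filterI dh (filterI n1 n2).
pose N := `|u| + `|v| + 1.
have N0 : 0 < N by rewrite ltr_pwDr // addr_ge0.
(* The parallelogram of side [s] at [x] then stays in the ball of radius [d]. *)
have [s s0 sN] : exists2 s, 0 < s & s * N < d.
  exists (d / (2 * N)); first by rewrite divr_gt0 // mulr_gt0.
  rewrite mulrAC ltr_pdivrMr ?mulr_gt0 // ltr_pM2l // ltr_pMl //.
  by rewrite ltr1n.
have inB a b : 0 <= a <= s -> 0 <= b <= s ->
    ball x d (a *: u + (b *: v + x)).
  move=> /andP[a0 as_] /andP[b0 bs]; rewrite -ball_normE /=.
  rewrite addrA opprD addrCA subrr addr0 normrN.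
  apply: le_lt_trans (ler_normD _ _) _; rewrite !normrZ !ger0_norm //.
  apply: le_lt_trans sN; rewrite /N !mulrDr mulr1.
  apply: ler_wpDr (ltW s0) _.
  by apply: lerD; apply: ler_wpM2r => //; exact: normr_ge0.
have [|a [b [as_ bs E1]]] := @second_difference h x u v s s0.
  move=> a b Ha Hb; have [[dh1 _ dh2 _] _] := Hd _ (inB a b Ha Hb).
  by split; [exact: dh1|rewrite (addrCA (b *: v)); exact: dh2].
have [|b' [a' [bs' as' E2]]] := @second_difference h x v u s s0.
  move=> b' a' Hb Ha; have [[_ dh1 _ dh2] _] := Hd _ (inB a' b' Ha Hb).
  by split; [rewrite (addrCA (b' *: v)); exact: dh1|exact: dh2].
have [_ [B1 _]] := Hd _ (inB a b as_ bs).
have [_ [_ B2]] := Hd _ (inB a' b' as' bs').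
rewrite (addrCA (a *: u)) in B1.
have AB : A (b *: v + (a *: u + x)) = B (a' *: u + (b' *: v + x)).
  apply: (@mulfI _ (s ^+ 2)); first by rewrite expf_neq0 // gt_eqF.
  rewrite -[LHS]E1 -[RHS]E2 (addrCA (s *: u)); ring.
rewrite AB in B1.
have := dist_lt_double B1 B2.
by rewrite -mulr2n -mulr_natr /e divfK ?ltxx // pnatr_eq0.
Qed.

End Schwarz.

Section ChainRule.
Context {R : realType}.

Lemma partialC n (U : set 'rV[R]_n) (h : 'rV[R]_n -> R) i j x :
  open U -> smooth_on U h -> U x ->
  partial i (partial j h) x = partial j (partial i h) x.
Proof.
move=> Uo Sh Ux; apply: derive_schwarz.
- apply: filterS (open_nbhs_nbhs (conj Uo Ux)) => y Uy; split;
    apply: diff_derivable.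
  + exact: smooth_differentiable Sh Uy.
  + exact: smooth_differentiable Sh Uy.
  + exact: smooth_differentiable (smooth_partial j Sh) Uy.
  + exact: smooth_differentiable (smooth_partial i Sh) Uy.
- exact: smooth_continuous (smooth_partial i (smooth_partial j Sh)) Ux.
- exact: smooth_continuous (smooth_partial j (smooth_partial i Sh)) Ux.
Qed.

Lemma differentiable_row (V : normedModType R) m (t : V -> 'rV[R]_m) x :
  (forall c, differentiable (fun y => t y 0 c) x) -> differentiable t x.
Proof.
move=> dt.
have -> : t = \sum_(c < m) (fun y => t y 0 c *: delta_mx 0 c).
  by apply/funext => y; rewrite fct_sumE -row_sum_delta.
apply: differentiable_sum => c.
exact: differentiableZl (dt c).
Qed.

Lemma jacobianE n m (t : 'rV[R]_n -> 'rV[R]_m) x i c :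
  (forall c, differentiable (fun y => t y 0 c) x) ->
  jacobian t x i c = partial i (fun y => t y 0 c) x.
Proof.
move=> dt; have dtx := differentiable_row dt.
rewrite !mxE -deriveE // derive_mx ?mxE //; exact: diff_derivable.
Qed.

Lemma partial_comp n m (t : 'rV[R]_n -> 'rV[R]_m) (f : 'rV[R]_m -> R) x i :
  (forall c, differentiable (fun y => t y 0 c) x) -> differentiable f (t x) ->
  differentiable (fun y => f (t y)) x /\
  partial i (fun y => f (t y)) x =
    \sum_c partial i (fun y => t y 0 c) x * partial c f (t x).
Proof.
move=> dt df; have dtx := differentiable_row dt.
have dc : differentiable (f \o t) x := differentiable_comp dtx df.
split; first exact: dc.
rewrite /partial (_ : (fun y => f (t y)) = f \o t) // deriveE //.
rewrite diff_comp //= -(deriveE _ dtx).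
rewrite [in LHS](row_sum_delta ('D_(delta_mx 0 i) t x)) linear_sum.
apply: eq_bigr => c _.
rewrite linearZ -(deriveE _ df) derive_mx ?mxE //; exact: diff_derivable.
Qed.

End ChainRule.

(** * Tensoriality of the Hessian *)

Section Tensor.
Context {F : numFieldType} {n : nat}.
Implicit Types (i j k l c d e : 'I_n).

(** The Christoffel symbols of the first kind, as a function of the array
[dG i j l] that stands for the i-th partial derivative of the entry (j, l) of
the metric. *)
Definition christoffel1 (dG : 'I_n -> 'I_n -> 'I_n -> F) l i j : F :=
  2^-1 * (dG i j l + dG j i l - dG l i j).

(** In the application [J] is the Jacobian of a change of coordinates t,
[K i j c] the second derivatives of t^c, and the hypothesis on [dG] is the
derivative of G = J H J^T. It has the shape A i j l + T i j l + A i l j, where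
the A terms carry the second derivatives of t and T is tensorial. Since A is
symmetric in its first two indices, four of the six A terms in the combination
dG i j l + dG j i l - dG l i j cancel, and the other two give A i j l twice. *)
Lemma christoffel1_change (J H : 'M[F]_n) (K dH dG : 'I_n -> 'I_n -> 'I_n -> F) :
  (forall i j c, K i j c = K j i c) -> H^T = H ->
  (forall i j l, dG i j l = \sum_c \sum_d
     (K i j c * H c d * J l d + J j c * (\sum_e J i e * dH e c d) * J l d
      + J j c * H c d * K i l d)) ->
  forall l i j, christoffel1 dG l i j =
    \sum_d J l d * (\sum_c K i j c * H c d
                    + \sum_c \sum_e J j c * J i e * christoffel1 dH d e c).
Proof.
move=> Ksym Hsym dGE.
pose A i j l := \sum_c \sum_d K i j c * H c d * J l d.
pose T i j l (X : 'I_n -> 'I_n -> 'I_n -> F) :=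
  \sum_c \sum_e \sum_d J j c * J i e * J l d * X c e d.
have TE i j l : dG i j l = A i j l + T i j l (fun c e d => dH e c d) + A i l j.
  rewrite dGE /A /T; under eq_bigr do rewrite !big_split /=.
  rewrite !big_split /=; congr (_ + _ + _).
    apply: eq_bigr => c _; rewrite exchange_big /=; apply: eq_bigr => d _.
    rewrite mulr_sumr mulr_suml; apply: eq_bigr => e _; ring.
  rewrite exchange_big /=; apply: eq_bigr => d _; apply: eq_bigr => c _.
  by rewrite -[in LHS]Hsym mxE; ring.
have Asym i j l : A i j l = A j i l.
  by apply: eq_bigr => c _; apply: eq_bigr => d _; rewrite Ksym.
move=> l i j; rewrite /christoffel1 !TE (Asym j i l) (Asym l i j) (Asym l j i).
have -> : T j i l (fun c e d => dH e c d) = T i j l (fun c e d => dH c e d).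
  rewrite /T exchange_big /=; apply: eq_bigr => c _; apply: eq_bigr => e _.
  by apply: eq_bigr => d _; ring.
have -> : T l i j (fun c e d => dH e c d) = T i j l (fun c e d => dH d e c).
  rewrite /T exchange_big /=.
  under eq_bigr do rewrite exchange_big /=.
  rewrite exchange_big /=; apply: eq_bigr => c _; rewrite exchange_big /=.
  apply: eq_bigr => e _; apply: eq_bigr => d _; ring.
have -> : \sum_d J l d * (\sum_c K i j c * H c d
    + \sum_c \sum_e J j c * J i e * christoffel1 dH d e c) =
    A i j l + T i j l (fun c e d => christoffel1 dH d e c).
  under eq_bigr do rewrite mulrDr.
  rewrite big_split /=; congr (_ + _).
    rewrite /A exchange_big /=; apply: eq_bigr => d _; rewrite mulr_sumr.
    by apply: eq_bigr => c _; ring.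
  rewrite /T; under eq_bigr do rewrite mulr_sumr.
  rewrite exchange_big /=; apply: eq_bigr => c _.
  under eq_bigr do rewrite mulr_sumr.
  rewrite exchange_big /=; apply: eq_bigr => e _.
  by apply: eq_bigr => d _; ring.
have -> : T i j l (fun c e d => christoffel1 dH d e c) =
   2^-1 * (T i j l (fun c e d => dH e c d) + T i j l (fun c e d => dH c e d)
     - T i j l (fun c e d => dH d e c)).
  rewrite /T -!big_split -sumrB mulr_sumr; apply: eq_bigr => c _.
  rewrite -!big_split -sumrB mulr_sumr; apply: eq_bigr => e _.
  rewrite -!big_split -sumrB mulr_sumr; apply: eq_bigr => d _.
  rewrite /christoffel1 /=; ring.
by field.
Qed.

(** The inverse metric transforms contravariantly. *)
Lemma invmx_congruence (J H : 'M[F]_n) : J *m H *m J^T \in unitmx ->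
  J^T *m invmx (J *m H *m J^T) *m J = invmx H.
Proof.
move=> uG; have := uG; rewrite !unitmx_mul => /andP[/andP[_ uH] uJ].
apply: (can_inj (mulmxK uH)); apply: (can_inj (mulmxK uJ)).
by rewrite mulVmx // mul1mx -!mulmxA (mulmxA J) mulVmx // mulmx1.
Qed.

(** Both sides are traces, and the trace is cyclic. *)
Lemma contraction_congruence (J H N : 'M[F]_n) : J *m H *m J^T \in unitmx ->
  \sum_i \sum_j invmx (J *m H *m J^T) i j * (J *m N *m J^T) i j =
  \sum_i \sum_j invmx H i j * N i j.
Proof.
move=> uG; rewrite -(invmx_congruence uG); set Gi := invmx _.
have trE (X Y : 'M[F]_n) : \sum_i \sum_j X i j * Y i j = \tr (X^T *m Y).
  rewrite /mxtrace exchange_big; apply: eq_bigr => i _; rewrite mxE.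
  by apply: eq_bigr => j _; rewrite mxE.
by rewrite !trE !mulmxA mxtrace_mulC !trmx_mul trmxK !mulmxA.
Qed.

(** The covariant Hessian is a tensor. By the chain rule [D2' i j] contains the
non-tensorial term sum_c K i j c D c; raising the index in
[christoffel1_change] shows that the Christoffel term of [J *m H *m J^T]
contains the same sum, and the two cancel. *)
Lemma hessian_change (J H : 'M[F]_n) (K dH dG : 'I_n -> 'I_n -> 'I_n -> F)
    (D D' : 'I_n -> F) (D2 D2' : 'I_n -> 'I_n -> F) :
  let G := J *m H *m J^T in
  G \in unitmx ->
  (forall i j c, K i j c = K j i c) -> H^T = H ->
  (forall i j l, dG i j l = \sum_c \sum_d
     (K i j c * H c d * J l d + J j c * (\sum_e J i e * dH e c d) * J l d
      + J j c * H c d * K i l d)) ->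
  (forall i, D' i = \sum_c J i c * D c) ->
  (forall i j, D2' i j = \sum_c (K i j c * D c
                                 + J j c * \sum_e J i e * D2 e c)) ->
  (\matrix_(i, j) (D2' i j - \sum_k (\sum_l invmx G k l * christoffel1 dG l i j) * D' k))
  = J *m (\matrix_(i, j) (D2 i j
       - \sum_k (\sum_l invmx H k l * christoffel1 dH l i j) * D k)) *m J^T.
Proof.
move=> G uG Ksym Hsym dGE D'E D2'E; apply/matrixP => i j.
have uH : H \in unitmx.
  by move: uG; rewrite /G !unitmx_mul => /andP[/andP[]].
pose Z : 'cV[F]_n := \col_d (\sum_c K i j c * H c d
                    + \sum_c \sum_e J j c * J i e * christoffel1 dH d e c).
pose Dv : 'rV[F]_n := \row_k D k.
have -> : (\matrix_(i, j) (D2' i j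
    - \sum_k (\sum_l invmx G k l * christoffel1 dG l i j) * D' k)) i j =
   D2' i j - \sum_k D k * \sum_l invmx H k l * Z l 0.
  rewrite mxE; congr (_ - _).
  have -> : \sum_k (\sum_l invmx G k l * christoffel1 dG l i j) * D' k =
    (Dv *m J^T *m (invmx G *m (J *m Z))) 0 0.
    rewrite mxE; apply: eq_bigr => k _; rewrite mulrC; congr (_ * _).
      by rewrite D'E mxE; apply: eq_bigr => c _; rewrite !mxE mulrC.
    rewrite mxE; apply: eq_bigr => l _; congr (_ * _).
    rewrite (christoffel1_change Ksym Hsym dGE) mxE.
    by apply: eq_bigr => d _; rewrite mxE.
  rewrite !mulmxA -(mulmxA Dv) -(mulmxA Dv) (invmx_congruence uG) -mulmxA.
  by rewrite mxE; apply: eq_bigr => k _; rewrite !mxE.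
(* Raising the index of Z: the second derivatives of t come out bare, because
   H multiplied by its inverse disappears. *)
have ZE k : \sum_l invmx H k l * Z l 0 = K i j k +
    \sum_c \sum_e J j c * J i e * \sum_l invmx H k l * christoffel1 dH l e c.
  under eq_bigr do rewrite mxE mulrDr.
  rewrite big_split /=; congr (_ + _).
    transitivity ((invmx H *m (H *m \col_c K i j c)) k 0).
      rewrite mxE; apply: eq_bigr => l _; congr (_ * _); rewrite mxE.
      by apply: eq_bigr => c _; rewrite -[in LHS]Hsym !mxE mulrC.
    by rewrite mulKmx // mxE.
  under eq_bigr do rewrite mulr_sumr.
  rewrite exchange_big /=; apply: eq_bigr => c _.
  under eq_bigr do rewrite mulr_sumr.
  rewrite exchange_big /=; apply: eq_bigr => e _.
  by rewrite mulr_sumr; apply: eq_bigr => l _; ring.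
under eq_bigr do rewrite ZE mulrDr.
rewrite D2'E !big_split /= opprD addrACA.
have -> : \sum_c K i j c * D c - \sum_c D c * K i j c = 0.
  by rewrite -sumrB big1 // => c _; ring.
rewrite add0r [RHS]mxE -sumrB.
have -> : \sum_k (J j k * (\sum_e J i e * D2 e k) - D k *
     (\sum_c \sum_e J j c * J i e * (\sum_l invmx H k l * christoffel1 dH l e c))) =
  \sum_c \sum_e J j c * J i e * (D2 e c -
     \sum_k (\sum_l invmx H k l * christoffel1 dH l e c) * D k).
  rewrite sumrB.
  transitivity (\sum_c \sum_e (J j c * J i e * D2 e c -
    \sum_k D k * (J j c * J i e * (\sum_l invmx H k l * christoffel1 dH l e c)))).
    under [in RHS]eq_bigr do rewrite sumrB.
    rewrite sumrB; congr (_ - _).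
      apply: eq_bigr => c _; rewrite mulr_sumr; apply: eq_bigr => e _; ring.
    under eq_bigr do rewrite mulr_sumr.
    rewrite exchange_big /=; apply: eq_bigr => c _.
    under eq_bigr do rewrite mulr_sumr.
    by rewrite exchange_big.
  apply: eq_bigr => c _; apply: eq_bigr => e _; rewrite mulrBr; congr (_ - _).
  rewrite mulr_sumr; apply: eq_bigr => k _; ring.
apply: eq_bigr => c _; rewrite !mxE mulr_suml; apply: eq_bigr => e _.
by rewrite mxE; ring.
Qed.

End Tensor.

(** * The Laplacian in coordinates *)

Section LaplacianCoord.
Context {R : realType} {n : nat}.
Implicit Types (U : set 'rV[R]_n) (h : 'rV[R]_n -> R) (G : 'rV[R]_n -> 'M[R]_n).

Lemma christoffelE G k i j x : christoffel G k i j x =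
  \sum_l invmx (G x) k l * christoffel1 (fun i j l => partial i (fun y => G y j l) x) l i j.
Proof.
by rewrite /christoffel mulr_sumr; apply: eq_bigr => l _; rewrite mulrCA.
Qed.

Lemma laplacian_coord_eq U G h h' x : open U -> U x -> {in U, h =1 h'} ->
  laplacian_coord G h x = laplacian_coord G h' x.
Proof.
move=> Uo Ux hh'; rewrite /laplacian_coord /codiff_coord; congr (- _).
have pE j : {in U, partial j h =1 partial j h'}.
  by move=> y; rewrite inE => Uy; exact: partial_eq hh'.
apply: eq_bigr => i _; apply: eq_bigr => j _; rewrite !mxE.
rewrite (partial_eq i Uo Ux (pE j)).
by under eq_bigr => k _ do rewrite pE ?inE //.
Qed.

Lemma laplacian_coord_linear U G (a : R) h h' x : open U -> U x ->
  smooth_on U h -> smooth_on U h' ->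
  laplacian_coord G (fun y => a * h y + h' y) x =
  a * laplacian_coord G h x + laplacian_coord G h' x.
Proof.
move=> Uo Ux Sh Sh'.
have pE (f f' : 'rV[R]_n -> R) j y : smooth_on U f -> smooth_on U f' -> U y ->
    partial j (fun z => a * f z + f' z) y = a * partial j f y + partial j f' y.
  move=> Sf Sf' Uy; have df := smooth_differentiable Sf Uy.
  rewrite partialD; last exact: smooth_differentiable Sf' Uy.
    by rewrite (partialM _ (differentiable_cst _ _) df) partial_cst mul0r add0r.
  exact: differentiableM (differentiable_cst _ _) df.
rewrite /laplacian_coord /codiff_coord mulrN -opprD; congr (- _).
rewrite mulr_sumr -big_split; apply: eq_bigr => i _ /=.
rewrite mulr_sumr -big_split; apply: eq_bigr => j _ /=; rewrite !mxE.
have -> : partial i (partial j (fun y => a * h y + h' y)) x =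
    a * partial i (partial j h) x + partial i (partial j h') x.
  rewrite -(pE _ _ _ _ (smooth_partial j Sh) (smooth_partial j Sh') Ux).
  by apply: (partial_eq _ Uo Ux) => y; rewrite inE => Uy; exact: pE.
have -> : \sum_k christoffel G k i j x * partial k (fun y => a * h y + h' y) x =
    a * (\sum_k christoffel G k i j x * partial k h x) +
    \sum_k christoffel G k i j x * partial k h' x.
  rewrite mulr_sumr -big_split; apply: eq_bigr => k _ /=.
  by rewrite (pE _ _ k x Sh Sh' Ux) mulrDr mulrCA.
by rewrite opprD addrACA -mulrBr mulrDr mulrCA.
Qed.

Lemma smooth_laplacian_coord U G h : open U ->
  (forall i j, smooth_on U (fun x => G x i j)) ->
  (forall x, U x -> G x \in unitmx) ->
  smooth_on U h -> smooth_on U (laplacian_coord G h).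
Proof.
move=> Uo SG uG Sh.
have SGi := smooth_invmx Uo SG uG.
have Schr i j k : smooth_on U (christoffel G k i j).
  move=> m; rewrite /christoffel; apply: CkM => //; first exact: Ck_cst.
  apply: Ck_sum => // l _; apply: CkM; [exact: Uo|exact: SGi|].
  have SdG i' j' l' := smooth_partial i' (SG j' l') m.
  apply: CkD; [exact: Uo|apply: CkD; [exact: Uo|exact: SdG|exact: SdG]|].
  under eq_fun do rewrite -mulN1r.
  by apply: CkM; [exact: Uo|exact: Ck_cst|exact: SdG].
have SN (f : 'rV[R]_n -> R) m : smooth_on U f -> Ck m U (fun x => - f x).
  move=> Sf; under eq_fun do rewrite -mulN1r.
  by apply: CkM; [exact: Uo|exact: Ck_cst|exact: Sf].
move=> m; rewrite /laplacian_coord /codiff_coord; apply: (SN) => {}m.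
apply: Ck_sum => // i _; apply: Ck_sum => // j _.
apply: CkM; [exact: Uo|exact: SGi|].
rewrite /cov_deriv; under eq_fun do rewrite mxE.
apply: CkD; [exact: Uo|exact: (smooth_partial i (smooth_partial j Sh))|].
apply: (SN) => {}m; apply: Ck_sum => // k _.
by apply: CkM; [exact: Uo|exact: Schr|exact: (smooth_partial k Sh)].
Qed.

(** Coordinate invariance of the Laplacian: differentiating the composition with
[t] and the relation G = J H J^T supplies the hypotheses of [hessian_change],
where the symmetry of the second derivatives of [t] is Schwarz's theorem; the
metric contraction of the Hessians then agrees by [contraction_congruence]. *)
Lemma laplacian_coord_change U (V : set 'rV[R]_n) (t : 'rV[R]_n -> 'rV[R]_n)
    G (H : 'rV[R]_n -> 'M[R]_n) h x :
  open U -> open V -> (forall y, U y -> V (t y)) ->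
  (forall c, smooth_on U (fun y => t y 0 c)) ->
  (forall i j, smooth_on V (fun y => H y i j)) ->
  (forall y, V y -> (H y)^T = H y) ->
  (forall y, U y -> G y \in unitmx) ->
  (forall y, U y -> G y = jacobian t y *m H (t y) *m (jacobian t y)^T) ->
  smooth_on V h -> U x ->
  laplacian_coord G (fun y => h (t y)) x = laplacian_coord H h (t x).
Proof.
move=> Uo Vo UV St SH Hsym uG GE Sh Ux.
have dt y : U y -> forall c, differentiable (fun z => t z 0 c) y.
  by move=> Uy c; exact: smooth_differentiable (St c) Uy.
have JE y i c : U y -> jacobian t y i c = partial i (fun z => t z 0 c) y.
  by move=> Uy; rewrite jacobianE //; exact: dt.
have dJ i c : differentiable (partial i (fun z => t z 0 c)) x.
  exact: smooth_differentiable (smooth_partial i (St c)) Ux.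
have chain (f : 'rV[R]_n -> R) y i : smooth_on V f -> U y ->
    differentiable (fun z => f (t z)) y /\ partial i (fun z => f (t z)) y =
    \sum_c partial i (fun z => t z 0 c) y * partial c f (t y).
  move=> Sf Uy; apply: partial_comp; first exact: dt.
  exact: smooth_differentiable Sf (UV y Uy).
pose J := jacobian t x.
pose K i j c := partial i (partial j (fun z => t z 0 c)) x.
pose dH e c d := partial e (fun y => H y c d) (t x).
pose dG i j l := partial i (fun y => G y j l) x.
have Ksym i j c : K i j c = K j i c by exact: partialC (St c) Ux.
have dGE i j l : dG i j l = \sum_c \sum_d
     (K i j c * H (t x) c d * J l d + J j c * (\sum_e J i e * dH e c d) * J l d
      + J j c * H (t x) c d * K i l d).
  pose T c d y := partial j (fun z => t z 0 c) y * H (t y) c d *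
      partial l (fun z => t z 0 d) y.
  have dT c d : differentiable (T c d) x /\ partial i (T c d) x =
      K i j c * H (t x) c d * J l d + J j c * (\sum_e J i e * dH e c d) * J l d
      + J j c * H (t x) c d * K i l d.
    have [dHt pHt] := chain _ x i (SH c d) Ux.
    have dJH := differentiableM (dJ j c) dHt.
    split; first exact: differentiableM dJH (dJ l d).
    rewrite /T (partialM _ dJH (dJ l d)) (partialM _ (dJ j c) dHt) pHt.
    rewrite -/(K i j c) -/(K i l d) mulrDl /J !JE //.
    by under [in RHS]eq_bigr do rewrite JE //.
  have -> : dG i j l = partial i (fun y => \sum_c \sum_d T c d y) x.
    apply: (partial_eq _ Uo Ux) => y; rewrite inE => Uy.
    rewrite GE // mxE exchange_big; apply: eq_bigr => d _ /=.
    rewrite [(_ *m _) j d]mxE [_^T d l]mxE mulr_suml.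
    by apply: eq_bigr => c _; rewrite !JE.
  have dTs c := partial_sum (index_enum 'I_n) i (fun d => (dT c d).1).
  have [_ ->] := partial_sum (index_enum 'I_n) i (fun c => (dTs c).1).
  apply: eq_bigr => c _; rewrite (dTs c).2; apply: eq_bigr => d _.
  exact: (dT c d).2.
pose D c := partial c h (t x).
pose D2 e c := partial e (partial c h) (t x).
have D'E i : partial i (fun y => h (t y)) x = \sum_c J i c * D c.
  by rewrite (chain h x i Sh Ux).2; apply: eq_bigr => c _; rewrite /J JE.
have D2'E i j : partial i (partial j (fun y => h (t y))) x =
    \sum_c (K i j c * D c + J j c * \sum_e J i e * D2 e c).
  pose T c y := partial j (fun z => t z 0 c) y * partial c h (t y).
  have dT c : differentiable (T c) x /\ partial i (T c) x =
      K i j c * D c + J j c * \sum_e J i e * D2 e c.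
    have [dh ph] := chain _ x i (smooth_partial c Sh) Ux.
    split; first exact: differentiableM (dJ j c) dh.
    rewrite /T (partialM _ (dJ j c) dh) ph /J !JE //.
    by under [in RHS]eq_bigr do rewrite JE //.
  transitivity (partial i (fun y => \sum_c T c y) x).
    apply: (partial_eq _ Uo Ux) => y; rewrite inE => Uy.
    by rewrite (chain h y j Sh Uy).2.
  have [_ ->] := partial_sum (index_enum 'I_n) i (fun c => (dT c).1).
  by apply: eq_bigr => c _; exact: (dT c).2.
have uGx := uG x Ux; rewrite (GE x Ux) in uGx.
have := hessian_change uGx Ksym (Hsym _ (UV x Ux)) dGE D'E D2'E.
have -> : (\matrix_(i, j) (partial i (partial j (fun y => h (t y))) x -
    \sum_k (\sum_l invmx (J *m H (t x) *m J^T) k l * christoffel1 dG l i j) *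
      partial k (fun y => h (t y)) x)) =
    cov_deriv G (fun j => partial j (fun y => h (t y))) x.
  apply/matrixP => i j; rewrite !mxE; congr (_ - _); apply: eq_bigr => k _.
  by rewrite christoffelE (GE x Ux).
have -> : (\matrix_(i, j) (D2 i j -
    \sum_k (\sum_l invmx (H (t x)) k l * christoffel1 dH l i j) * D k)) =
    cov_deriv H (fun j => partial j h) (t x).
  apply/matrixP => i j; rewrite !mxE; congr (_ - _); apply: eq_bigr => k _.
  by rewrite christoffelE.
move=> E; rewrite /laplacian_coord /codiff_coord E (GE x Ux).
by rewrite (contraction_congruence _ uGx).
Qed.

End LaplacianCoord.

(** * The Laplacian on a pseudo-Riemannian manifold *)

Section Manifold.
Context {R : realType} {n : nat} {M : topologicalType}.
Context {S : smooth_manifold R n M}.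
Implicit Types (u v : M -> R) (p : M) (a b : chart_index S).

Lemma overlap_open (a b : chart R n M) : open (overlap a b).
Proof.
rewrite openE => x [ax bx].
have ca : {in cimg a, continuous (cinv a)}.
  by rewrite -continuous_open_subspace; [exact: cinv_continuous|exact: cimg_open].
have nb : nbhs (cinv a x) (cdom b).
  by apply: open_nbhs_nbhs; split; [exact: cdom_open|].
apply: filterI; first by apply: open_nbhs_nbhs; split; [exact: cimg_open|].
by apply: (ca x); rewrite ?inE.
Qed.

Lemma smooth_fun_lin (c : R) u v :
  smooth_fun S u -> smooth_fun S v -> smooth_fun S (fun p => c * u p + v p).
Proof.
move=> Su Sv a k; have Uo := @cimg_open _ _ _ (atlas a).
apply: (CkD Uo); last exact: (Sv a k).
by apply: (CkM Uo); [exact: Ck_cst|exact: (Su a k)].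
Qed.

Variable g : pseudo_riemannian_metric S.

(** The definition of [laplacian] evaluates at each point in the chart chosen
for that point, so its value at nearby points may come from unrelated charts.
Invariance lets a single chart serve all points of its domain; this is what
makes [laplacian g u] smooth. *)
Lemma laplacianE u a x : smooth_fun S u -> cimg (atlas a) x ->
  laplacian g u (cinv (atlas a) x) =
  laplacian_coord (metric g a) (fun y => u (cinv (atlas a) y)) x.
Proof.
move=> Su ax; rewrite /laplacian.
set b := chart_at S _.
have bx : cdom (atlas b) (cinv (atlas a) x) by exact: chart_at_dom.
pose U := overlap (atlas a) (atlas b).
have Uo : open U by exact: overlap_open.
have Ux : U x by [].
pose t := transition (atlas a) (atlas b).
have E : {in U, (fun y => u (cinv (atlas a) y)) =1
                (fun y => u (cinv (atlas b) (t y)))}.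
  by move=> y; rewrite inE => -[_ by_]; rewrite /t /transition cmapK.
rewrite (laplacian_coord_eq _ Uo Ux E).
rewrite (@laplacian_coord_change _ _ U (cimg (atlas b)) t _ (metric g b)
  (fun y => u (cinv (atlas b) y)) x) //.
- exact: cimg_open.
- by move=> y [_ ?]; exact: cmap_img.
- by move=> c; exact: atlas_compatible.
- by move=> i j; exact: metric_smooth.
- by move=> y; exact: Defs.metric_sym.
- by move=> y [? _]; exact: metric_nondegenerate.
- by move=> y; exact: metric_change.
Qed.

Lemma smooth_laplacian u : smooth_fun S u -> smooth_fun S (laplacian g u).
Proof.
move=> Su a k; have Uo := @cimg_open _ _ _ (atlas a).
apply: (@Ck_eq _ _ _ _ (laplacian_coord (metric g a)
  (fun y => u (cinv (atlas a) y)))) => //.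
  by move=> x; rewrite inE => ax; rewrite laplacianE.
apply: smooth_laplacian_coord => //.
- by move=> i j; exact: metric_smooth.
- by move=> x; exact: metric_nondegenerate.
Qed.

Lemma laplacian_lin (c : R) u v : smooth_fun S u -> smooth_fun S v ->
  laplacian g (fun p => c * u p + v p) =
  (fun p => c * laplacian g u p + laplacian g v p).
Proof.
move=> Su Sv; apply/funext => p; rewrite /laplacian.
set a := chart_at S p.
have Ux : cimg (atlas a) (cmap (atlas a) p) by apply/cmap_img/chart_at_dom.
exact: laplacian_coord_linear (@cimg_open _ _ _ (atlas a)) Ux (Su a) (Sv a).
Qed.

(** Tracing Ric = lam g gives Sc = n lam. On the empty manifold n lam may vanish,
but there any nonzero constant will do. *)
Lemma scalar_curvature_cst : einstein g ->
  (forall p, scalar_curvature g p != 0) ->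
  exists2 s : R, s != 0 & forall p, scalar_curvature g p = s.
Proof.
case=> lam Ric nz.
have ScE p : scalar_curvature g p = lam * n%:R.
  rewrite /scalar_curvature /scalar_coord.
  set a := chart_at S p; set x := cmap _ _.
  have ax : cimg (atlas a) x by apply/cmap_img/chart_at_dom.
  have uG := metric_nondegenerate g ax.
  transitivity (lam * \tr (invmx (metric g a x) *m metric g a x)).
    rewrite Ric // /mxtrace mulr_sumr; apply: eq_bigr => i _.
    rewrite mxE mulr_sumr; apply: eq_bigr => j _.
    by rewrite mxE mulrCA -{2}(Defs.metric_sym g ax) mxE.
  by rewrite mulVmx // mxtrace1.
have [[p _]|M0] := pselect (exists p : M, True).
  by exists (lam * n%:R) => //; rewrite -(ScE p).
by exists 1 => [|p]; [exact: oner_neq0|case: M0; exists p].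
Qed.

End Manifold.

(** * Partial fractions for polynomials in an operator *)

Section Lagrange.
Context {F : fieldType} {k : nat}.
Variable c : 'I_k -> F.
Hypothesis cI : injective c.

Definition lagrange_weight (i : 'I_k) : F := \prod_(j | j != i) (c j - c i)^-1.

Definition cofactor_poly (i : 'I_k) : {poly F} :=
  \prod_(j | j != i) ('X + (c j)%:P).

Lemma horner_cofactor_poly i l : (cofactor_poly i).[- c l] =
  if l == i then (lagrange_weight i)^-1 else 0.
Proof.
rewrite /cofactor_poly horner_prod; under eq_bigr do rewrite hornerD hornerX hornerC addrC.
case: eqVneq => [->|li]; last by rewrite (bigD1 l) //= subrr mul0r.
rewrite /lagrange_weight -prodfV; apply: eq_bigr => j _.
by rewrite invrK.
Qed.

Lemma lagrange_weight_neq0 i : lagrange_weight i != 0.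
Proof.
apply/prodf_neq0 => j ji; rewrite invr_eq0 subr_eq0.
by apply: contra ji => /eqP/cI ->.
Qed.

(** The partial fraction decomposition of 1 / prod_i ('X + c_i), with cleared
denominators: the difference of the two sides has degree less than [k] and the
[k] distinct roots - c_l. *)
Lemma lagrange_cofactor : (0 < k)%N ->
  \sum_i lagrange_weight i *: cofactor_poly i = 1.
Proof.
move=> k0; apply/eqP; rewrite -subr_eq0; apply/eqP.
apply: (@roots_geq_poly_eq0 _ _ [seq - c l | l : 'I_k]).
- apply/allP => _ /mapP[l _ ->]; rewrite /root hornerD hornerN hornerC.
  rewrite horner_sum (bigD1 l) //= big1 => [|i il].
    by rewrite addr0 hornerZ horner_cofactor_poly eqxx divff ?lagrange_weight_neq0 // subrr.
  by rewrite hornerZ horner_cofactor_poly eq_sym (negPf il) mulr0.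
- by rewrite map_inj_uniq ?enum_uniq // => i j /oppr_inj/cI.
rewrite size_map -cardE card_ord; apply: leq_trans (size_polyD _ _) _.
rewrite size_polyN size_poly1 geq_max k0 andbT.
apply: leq_trans (size_sum _ _ _) _; apply/bigmax_leqP => i _.
apply: leq_trans (size_scale_leq _ _) _.
rewrite /cofactor_poly; apply: leq_trans (size_poly_prod_leq _ _) _.
under eq_bigr do rewrite size_XaddC.
rewrite sum_nat_const cardC1 card_ord muln2 -addnn subSn ?leq_addr //.
by rewrite addnK prednK.
Qed.

End Lagrange.

(** An operator is assumed linear only on a subspace [D] that it preserves, since
a differential operator that is total on functions is linear only on the smooth
ones. Composition of polynomials in [T] then behaves well on [D]. *)
Section PolyAction.
Context {F : fieldType} {V : lmodType F}.
Variables (D : V -> Prop) (T : V -> V).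
Hypothesis D_lin : forall (a : F) u v, D u -> D v -> D (a *: u + v).
Hypothesis D_T : forall u, D u -> D (T u).
Hypothesis T_lin : forall (a : F) u v, D u -> D v ->
  T (a *: u + v) = a *: T u + T v.
Implicit Types (p q : {poly F}) (u v : V).

Definition polyact p v := \sum_(i < size p) p`_i *: iter i T v.

Lemma polyact_widen m p v : (size p <= m)%N ->
  polyact p v = \sum_(i < m) p`_i *: iter i T v.
Proof.
move=> pm; rewrite /polyact (big_ord_widen _ (fun i => p`_i *: iter i T v) pm).
rewrite big_mkcond; apply: eq_bigr => i _; case: ltnP => // pi.
by rewrite nth_default // scale0r.
Qed.

Lemma polyact0 v : polyact 0 v = 0.
Proof. by rewrite /polyact size_poly0 big_ord0. Qed.

Lemma polyact_lin (a : F) p q v : polyact (a *: p + q) v = a *: polyact p v + polyact q v.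
Proof.
pose m := maxn (size (a *: p + q)) (maxn (size p) (size q)).
rewrite !(@polyact_widen m) ?leq_max ?leqnn ?orbT //.
rewrite scaler_sumr -big_split; apply: eq_bigr => i _ /=.
by rewrite coefD coefZ scalerDl scalerA.
Qed.

Lemma polyact_sum (I : finType) (a : I -> F) (p : I -> {poly F}) v :
  polyact (\sum_i a i *: p i) v = \sum_i a i *: polyact (p i) v.
Proof.
apply: (big_rec2 (fun x y => polyact x v = y)); first exact: polyact0.
by move=> i x y _ <-; exact: polyact_lin.
Qed.

Lemma polyactC (a : F) v : polyact a%:P v = a *: v.
Proof. by rewrite (@polyact_widen 1) ?size_polyC_leq1 // big_ord1 coefC. Qed.

Lemma polyact_cons p (a : F) v : polyact (p * 'X + a%:P) v = polyact p (T v) + a *: v.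
Proof.
rewrite (@polyact_widen (size p).+1); last first.
  apply: leq_trans (size_polyD _ _) _; rewrite geq_max size_polyC.
  by rewrite (leq_trans (size_polyMleq _ _)) ?size_polyX ?addn2 //; case: eqP.
rewrite big_ord_recl coefD coefMX coefC /= add0r addrC; congr (_ + _).
apply: eq_bigr => i _; rewrite coefD coefMX coefC /= addr0.
by rewrite -iterSr.
Qed.

Lemma D_0 u : D u -> D 0.
Proof. by move=> Du; rewrite -(addNr u) -scaleN1r; exact: D_lin. Qed.

Lemma D_sum (I : finType) (a : I -> F) (u : I -> V) : D 0 ->
  (forall i, D (u i)) -> D (\sum_i a i *: u i).
Proof.
by move=> D0 Du; apply: (big_rec D) => // i x _ Dx; exact: D_lin.
Qed.

Lemma D_polyact p u : D u -> D (polyact p u).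
Proof.
move=> Du; apply: D_sum; first exact: D_0 Du.
by move=> i; elim: (val i) => //= m; exact: D_T.
Qed.

Lemma T_0 : D 0 -> T 0 = 0.
Proof.
by move=> D0; have := T_lin (-1) D0 D0; rewrite scaler0 addr0 scaleN1r addNr.
Qed.

Lemma T_polyact p u : D u -> T (polyact p u) = polyact p (T u).
Proof.
elim/poly_ind: p u => [|p a IH] u Du; first by rewrite !polyact0 T_0 //; exact: D_0 Du.
rewrite !polyact_cons addrC T_lin //; last exact/D_polyact/D_T.
by rewrite IH 1?addrC //; exact: D_T.
Qed.

(** This rests on [T] commuting with polynomials in [T], and makes the order in
which the factors of a product are composed immaterial. *)
Lemma polyact_mul p q u : D u -> polyact (p * q) u = polyact p (polyact q u).
Proof.
elim/poly_ind: p u => [|p a IH] u Du; first by rewrite mul0r !polyact0.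
rewrite mulrDl mulrAC mul_polyC addrC polyact_lin polyact_cons addrC; congr (_ + _).
rewrite T_polyact // -IH; last exact: D_T.
by have := polyact_cons (p * q) 0 u; rewrite polyC0 addr0 scale0r addr0.
Qed.

Lemma polyact_XaddC (a : F) u : polyact ('X + a%:P) u = T u + a *: u.
Proof. by rewrite -['X]mul1r polyact_cons -polyC1 polyactC scale1r. Qed.

Lemma polyact_argument_lin p (a : F) u v : D u -> D v ->
  polyact p (a *: u + v) = a *: polyact p u + polyact p v.
Proof.
elim/poly_ind: p u v => [|p b IH] u v Du Dv; first by rewrite !polyact0 scaler0 addr0.
rewrite !polyact_cons T_lin // IH; try exact: D_T.
by rewrite !scalerDr !scalerA [b * a]mulrC addrACA.
Qed.

Lemma polyact_argument_sum p (I : finType) (a : I -> F) (u : I -> V) : D 0 ->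
  (forall i, D (u i)) ->
  polyact p (\sum_i a i *: u i) = \sum_i a i *: polyact p (u i).
Proof.
move=> D0 Du.
suff [] : D (\sum_i a i *: u i) /\
    polyact p (\sum_i a i *: u i) = \sum_i a i *: polyact p (u i) by [].
apply: (big_rec2 (fun x y => D x /\ polyact p x = y)).
  by split=> //; elim/poly_ind: p => [|p b IH]; rewrite ?polyact0 // polyact_cons T_0 // IH scaler0 addr0.
by move=> i x y _ [Dx <-]; split; [exact: D_lin|exact: polyact_argument_lin].
Qed.

Lemma polyact_eigen p (m : F) u : D u -> T u = m *: u -> polyact p u = p.[m] *: u.
Proof.
move=> Du Tu; elim/poly_ind: p => [|p a IH]; first by rewrite polyact0 horner0 scale0r.
rewrite polyact_cons hornerD hornerMX hornerC scalerDl Tu.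
have := polyact_argument_lin p m Du (D_0 Du); rewrite !addr0 => ->.
rewrite IH scalerA.
have -> : polyact p 0 = 0 by have := polyact_argument_lin p (-1) Du Du;
  rewrite scaleN1r addNr scaleN1r addNr.
by rewrite addr0 mulrC.
Qed.

Section Decomposition.
Variables (k : nat) (c : 'I_k -> F) (f : V).
Hypotheses (k0 : (0 < k)%N) (cI : injective c) (Df : D f).

Definition shift_systems : set ('I_k -> V) :=
  [set us | forall i, D (us i) /\ T (us i) + c i *: us i = f].

Definition product_solutions : set V :=
  [set u | D u /\ polyact (\prod_i ('X + (c i)%:P)) u = f].

(** The inverse map sends [u] to the family whose i-th member is
[polyact (cofactor_poly c i) u]. That the two maps compose to the identity on
[u], and that the reassembled function solves the product equation, both follow
by applying the identity [lagrange_cofactor] to [T]. Injectivity: the i-th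
component of the difference of two systems is an eigenvector of [T] for - c_i,
and eigenvectors for distinct eigenvalues are independent; [cofactor_poly c i]
applied to [T] kills all components but the i-th. *)
Lemma shift_systems_bij : set_bij shift_systems product_solutions
  (fun us => \sum_i lagrange_weight c i *: us i).
Proof.
have D0 := D_0 Df.
have PE i : \prod_i ('X + (c i)%:P) = ('X + (c i)%:P) * cofactor_poly c i.
  by rewrite (bigD1 i).
split.
- move=> us Hus; have Dus i := (Hus i).1; split; first exact: D_sum.
  rewrite polyact_argument_sum //.
  transitivity (\sum_i lagrange_weight c i *: polyact (cofactor_poly c i) f).
    apply: eq_bigr => i _.
    by rewrite (PE i) mulrC polyact_mul // polyact_XaddC (Hus i).2.
  by rewrite -polyact_sum (lagrange_cofactor cI k0) -polyC1 polyactC scale1r.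
- move=> us vs; rewrite !inE => Hus Hvs E; apply/funext => i.
  apply/eqP; rewrite -subr_eq0; apply/eqP.
  pose d l := us l - vs l.
  have Dd l : D (d l).
    by rewrite /d addrC -scaleN1r; apply: D_lin; [exact: (Hvs l).1|exact: (Hus l).1].
  have Td l : T (d l) = - c l *: d l.
    rewrite /d addrC -scaleN1r T_lin; [|exact: (Hvs l).1|exact: (Hus l).1].
    have -> : T (us l) = f - c l *: us l by rewrite -(Hus l).2 addrK.
    have -> : T (vs l) = f - c l *: vs l by rewrite -(Hvs l).2 addrK.
    by rewrite !scaleN1r opprB addrA subrK scaleNr scalerDr scalerN opprD opprK.
  have : polyact (cofactor_poly c i) (\sum_l lagrange_weight c l *: d l) = 0.
    have -> : \sum_l lagrange_weight c l *: d l = 0.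
      rewrite /d; under eq_bigr do rewrite scalerBr.
      by rewrite sumrB; apply/eqP; rewrite subr_eq0; apply/eqP.
    have := polyact_argument_lin (cofactor_poly c i) (-1) D0 D0.
    by rewrite scaleN1r addNr scaleN1r addNr.
  rewrite polyact_argument_sum // (bigD1 i) //= big1 ?addr0 => [|l li].
    rewrite (polyact_eigen _ (Dd i) (Td i)) horner_cofactor_poly eqxx scalerA.
    by rewrite divff ?scale1r ?lagrange_weight_neq0.
  rewrite (polyact_eigen _ (Dd l) (Td l)) horner_cofactor_poly (negPf li).
  by rewrite scale0r scaler0.
- move=> u [Du Pu]; exists (fun i => polyact (cofactor_poly c i) u).
    move=> i; split; first exact: D_polyact.
    by rewrite -polyact_XaddC -polyact_mul // -PE.
  by rewrite -polyact_sum (lagrange_cofactor cI k0) -polyC1 polyactC scale1r.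
Qed.

End Decomposition.
End PolyAction.

(** * GJMS operators on Einstein manifolds *)

Lemma dim_neq0 (R : realType) (n : nat) : (2 <= n)%N ->
  (n%:R : R) != 0 /\ (n%:R - 1 : R) != 0.
Proof.
move=> n2; rewrite subr_eq0 -[1]/(1%:R) eqr_nat pnatr_eq0.
by case: n n2 => [|[]].
Qed.

Lemma gjms_coef_diff (R : realType) (n i j : nat) : (2 <= n)%N ->
  @gjms_coef R n j - @gjms_coef R n i =
  - ((j%:R - i%:R) * (j%:R + i%:R - 1) / (n%:R * (n%:R - 1))).
Proof.
move=> /(@dim_neq0 R)[n0 n1].
by rewrite /gjms_coef; field; rewrite n0 n1.
Qed.

Lemma conformal_laplacian_plus_ScE (R : realType) (n : nat) (M : topologicalType)
    (S : smooth_manifold R n M) (g : pseudo_riemannian_metric S) (i : nat)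
    (u : M -> R) : (2 <= n)%N ->
  conformal_laplacian_plus_Sc g (@gjms_b R n i) u =
  laplacian_plus_Sc g (@gjms_coef R n i) u.
Proof.
move=> /(@dim_neq0 R)[n0 n1]; apply/funext => p.
rewrite /conformal_laplacian_plus_Sc /conformal_laplacian /laplacian_plus_Sc.
rewrite -addrA -mulrDl -mulrDl; congr (_ + _ * _ * _).
by rewrite /gjms_b /gjms_coef; field; rewrite n0 n1.
Qed.

Section GJMSAction.
Context {R : realType} {n : nat} {M : topologicalType}.
Context {S : smooth_manifold R n M} {g : pseudo_riemannian_metric S}.
Context {s : R}.
Hypothesis Sc_s : forall p, scalar_curvature g p = s.

(* With values in R^o, functions form a vector space over R. *)
Let V : lmodType R := M -> R^o.
Let T : V -> V := laplacian g.
Let D : V -> Prop := smooth_fun S.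

Lemma laplacian_plus_Sc_polyact c (u : V) :
  laplacian_plus_Sc g c u = polyact T ('X + (c * s)%:P) u.
Proof.
by rewrite polyact_XaddC; apply/funext => p; rewrite /laplacian_plus_Sc Sc_s.
Qed.

Lemma gjms_polyact k (u : V) : D u ->
  gjms g k u = polyact T (\prod_(i < k) ('X + (@gjms_coef R n i.+1 * s)%:P)) u.
Proof.
move=> Du.
have -> : \prod_(i < k) ('X + (@gjms_coef R n i.+1 * s)%:P) =
    \prod_(1 <= i < k.+1) ('X + (@gjms_coef R n i * s)%:P).
  by rewrite big_add1 /= big_mkord.
rewrite /gjms; elim: (index_iota _ _) => [|i r IH].
  by rewrite !big_nil -polyC1 polyactC scale1r.
rewrite !big_cons /= laplacian_plus_Sc_polyact IH.
rewrite (@polyact_mul _ _ D) //.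
- exact: smooth_fun_lin.
- exact: smooth_laplacian.
- exact: laplacian_lin.
Qed.

End GJMSAction.

Theorem proposition5p4 (R : realType) (n : nat) (hn : (3 <= n)%N)
    (M : topologicalType) (S : smooth_manifold R n M)
    (g : pseudo_riemannian_metric S) (hE : einstein g)
    (hSc : forall p : M, scalar_curvature g p != 0)
    (k : nat) (hk : (0 < k)%N) (f : M -> R) (hf : smooth_fun S f) :
  set_bij (second_order_solutions g k f) (gjms_solutions g k f)
    (reassemble g k).
Proof.
have n2 : (2 <= n)%N := ltnW hn.
have [s s0 Sc_s] := scalar_curvature_cst hE hSc.
have nn0 : (n%:R * (n%:R - 1) : R) != 0.
  by have [n0 n1] := @dim_neq0 R n n2; rewrite mulf_neq0.
pose c (i : 'I_k) : R := @gjms_coef R n i.+1 * s.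
(* The weights in [reassemble] are products of inverses of these differences. *)
have cB i j : c j - c i =
    - ((n%:R * (n%:R - 1)) / s)^-1 * ((j.+1%:R - i.+1%:R) * (j.+1%:R + i.+1%:R - 1)).
  by rewrite /c -mulrBl gjms_coef_diff // invf_div; ring.
have cI : injective c.
  move=> i j cij; apply/eqP; rewrite eq_sym -val_eqE /=.
  have /eqP := cB i j; rewrite cij subrr eq_sym mulf_eq0 oppr_eq0 invr_eq0.
  rewrite mulf_eq0 (negPf nn0) invr_eq0 (negPf s0) /= mulf_eq0 => /orP[].
    by rewrite subr_eq0 eqr_nat eqSS.
  (* The second factor is i + j - 1 with i, j >= 1, hence at least 1. *)
  by rewrite -[X in _ - X]/(1%:R) subr_eq0 -natrD eqr_nat addSn addnS.
have := @shift_systems_bij R (M -> R^o) (smooth_fun S) (laplacian g)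
  (@smooth_fun_lin _ _ _ _) (@smooth_laplacian _ _ _ _ g)
  (@laplacian_lin _ _ _ _ g) k c f hk cI hf.
have -> : shift_systems (smooth_fun S) (laplacian g) c f =
    second_order_solutions g k f.
  apply/seteqP; split=> us Hus i; have [Dus Eus] := Hus i; split=> //.
    rewrite conformal_laplacian_plus_ScE // (laplacian_plus_Sc_polyact Sc_s).
    by rewrite polyact_XaddC.
  move: Eus; rewrite conformal_laplacian_plus_ScE // (laplacian_plus_Sc_polyact Sc_s).
  by rewrite polyact_XaddC.
have -> : product_solutions (smooth_fun S) (laplacian g) c f =
    gjms_solutions g k f.
  by apply/seteqP; split=> u [Du Eu]; split=> //; move: Eu;
    rewrite (gjms_polyact Sc_s).
have -> // : (fun us : 'I_k -> M -> R^o => \sum_i lagrange_weight c i *: us i) =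
  reassemble g k.
apply/funext => us; apply/funext => p.
rewrite /reassemble fct_sumE Sc_s mulr_sumr; apply: eq_bigr => i _.
rewrite mulrA; congr (_ * _).
rewrite /lagrange_weight.
under eq_bigr do rewrite cB invfM invrN invrK.
rewrite big_split /= prodr_const; congr (_ ^+ _ * _).
by rewrite cardC1 card_ord.
Qed.
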